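(* There exists a function $f:(0,\infty)\to[0,\infty)$ with $\lim_{C\to\infty}f(C)=0$ such that the following holds. Let $n\ge3$, let $G$ be the torus graph on $\mathbb{Z}_n^2$ with edges $\{(i,j),(i+1,j)\}$ and $\{(i,j),(i,j+1)\}$, and let $v_1,\dots,v_m\in G$ be any collection of distinct vertices such that no two of them lie in a common square $\{(i,j),(i+1,j),(i,j+1),(i+1,j+1)\}$. Let $X_t$ be the Markov chain with kernel $Q$, the Metropolis--Hastings walk associated with $G\setminus\{v_1,\dots,v_m\}$, started from an arbitrary state, and let $\nu$ be its (uniform) stationary distribution. Then for $t=Cn^2$ (with $C>0$ such that $t$ is an integer), $$\|\mathcal{L}(X_t)-\nu\|_{TV}\le f(C).$$ In particular $f$ does not depend on $n$ or on the particular vertices removed.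
   Context: All coordinates are taken modulo $n$. The Metropolis--Hastings walk $Q$ on $V=G\setminus\{v_1,\dots,v_m\}$ is given by $Q(x,y)=\frac18$ if $x,y\in V$ are adjacent in $G$, $Q(x,x)=1-\frac18\deg_V(x)$ where $\deg_V(x)$ is the number of neighbours of $x$ in $V$, and $0$ otherwise; its stationary distribution $\nu$ is uniform on $V$. $\mathcal{L}(X_t)$ denotes the law of $X_t$ and $\|\cdot\|_{TV}$ total variation distance. *)

(* Defs.v *)
From HB Require Import structures.
From mathcomp Require Import all_boot all_order all_algebra.
From mathcomp Require Import all_classical all_reals all_analysis.

Set Implicit Arguments.
Unset Strict Implicit.
Unset Printing Implicit Defensive.
Import Order.TTheory GRing.Theory Num.Theory.
Import numFieldNormedType.Exports.
Local Open Scope classical_set_scope.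
Local Open Scope ring_scope.

(* ['Z_n] is the integers mod n only for n >= 2. *)
Definition torus (n : nat) : finType := ('Z_n * 'Z_n)%type.

Definition torus_adj (n : nat) (x y : torus n) : bool :=
  [|| y == (x.1 + 1, x.2), x == (y.1 + 1, y.2),
      y == (x.1, x.2 + 1) | x == (y.1, y.2 + 1)].

Definition square (n : nat) (i j : 'Z_n) : seq (torus n) :=
  [:: (i, j); (i + 1, j); (i, j + 1); (i + 1, j + 1)].

Definition no_common_square (n m : nat) (v : m.-tuple (torus n)) : Prop :=
  forall (a b : 'I_m) (i j : 'Z_n), a != b ->
    ~ (tnth v a \in square i j /\ tnth v b \in square i j).

Definition remaining (n m : nat) (v : m.-tuple (torus n)) : finType :=
  {x : torus n | x \notin v}.

Definition degree (n m : nat) (v : m.-tuple (torus n)) (x : remaining v) : nat :=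
  #|[pred y : remaining v | torus_adj (val x) (val y)]|.

Definition MH (R : realType) (n m : nat) (v : m.-tuple (torus n))
    (x y : remaining v) : R :=
  if x == y then 1 - (degree x)%:R / 8
  else if torus_adj (val x) (val y) then 1 / 8 else 0.

Definition uniform_dist (R : realType) (T : finType) (x : T) : R := #|T|%:R^-1.

Definition stationary (R : realType) (T : finType) (Q : T -> T -> R)
    (mu : T -> R) : Prop :=
  forall y, \sum_x mu x * Q x y = mu y.

(* The largest discrepancy over events; mu and nu are mass functions. *)
Definition tv_dist (R : realType) (T : finType) (mu nu : T -> R) : R :=
  \big[Num.max/0]_(A : {set T}) `|\sum_(x in A) mu x - \sum_(x in A) nu x|.

Definition law d (Omega : measurableType d) (R : realType)
    (P : probability Omega R) (T : finType) (X : Omega -> T) (x : T) : R :=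
  fine (P (X @^-1` [set x])).

(* [history X h t] is the event that X_i = h i for every i <= t.  The transition
   rule is P(X_(t+1) = h (t+1) | X_0 = h 0, ..., X_t = h t) = Q (h t) (h (t+1)),
   cleared of its denominator so that it is also meaningful (and automatic)
   for null histories. *)
Definition history (Omega : Type) (T : Type) (X : nat -> Omega -> T)
    (h : nat -> T) (t : nat) : set Omega :=
  [set w | forall i, (i <= t)%N -> X i w = h i].

Record markov_chain d (Omega : measurableType d) (R : realType)
    (P : probability Omega R) (T : finType) (Q : T -> T -> R) (x0 : T)
    (X : nat -> Omega -> T) : Prop := MarkovChain {
  chain_measurable : forall t x, measurable (X t @^-1` [set x]);
  chain_start : P (X 0%N @^-1` [set x0]) = 1%E;
  chain_step : forall (h : nat -> T) (t : nat),
    P (history X h t.+1) = (P (history X h t) * (Q (h t) (h t.+1))%:E)%E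
}.

Lemma torus_adjC (n : nat) (x y : torus n) : torus_adj x y = torus_adj y x.
Proof.
by rewrite /torus_adj orbCA; do 2 congr orb; rewrite orbC.
Qed.

Lemma torus_adj_irrefl (n : nat) (x : torus n) : torus_adj x x = false.
Proof.
have sE (i : 'Z_n) : (i == i + 1) = false.
  by rewrite -{1}[i]addr0 (inj_eq (addrI i)) eq_sym oner_eq0.
by case: x => i j; rewrite /torus_adj !xpair_eqE !sE !andbF.
Qed.

Lemma MH_row_sum (R : realType) (n m : nat) (v : m.-tuple (torus n))
    (x : remaining v) : \sum_y MH R x y = 1.
Proof.
rewrite (bigD1 x) //= {1}/MH eqxx.
have -> : \sum_(y | y != x) MH R x y =
          \sum_(y : remaining v | torus_adj (val x) (val y)) 8^-1.
  rewrite [RHS](bigID (fun y => y == x)) /= [X in _ = X + _]big1 ?add0r; last first.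
    by move=> y /andP[+ /eqP yx]; rewrite yx torus_adj_irrefl.
  rewrite [RHS]big_mkcondl; apply: eq_bigr => y yx.
  by rewrite /MH eq_sym (negPf yx) div1r.
by rewrite sumr_const /degree -[X in _ + X]mulr_natl subrK.
Qed.

Lemma uniform_stationary (R : realType) (n m : nat) (v : m.-tuple (torus n)) :
  stationary (@MH R n m v) (@uniform_dist R (remaining v)).
Proof.
move=> y; rewrite /uniform_dist -mulr_sumr.
rewrite (eq_bigr (fun x => MH R y x)) ?MH_row_sum ?mulr1 // => x _.
by rewrite /MH eq_sym torus_adjC; case: eqP => [->|].
Qed.

(* Main.v *)
Require Import Defs.
From HB Require Import structures.
From mathcomp Require Import all_boot all_order all_algebra.
From mathcomp Require Import all_classical all_reals all_analysis.
From mathcomp Require Import ring lra.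

(* Let [g = L(X_t) - nu] and [u_t = ||g||_2^2].  Since [g] has mean zero and
   [||g||_1 <= 2], a Nash inequality [u_t^2 <= K E(g)] turns the one-step loss of
   the lazy walk, [u_t - u_{t+1} >= E(g) / 16], into [u_{t+1} <= u_t - c u_t^2],
   so that [u_t <= 1 / (c t)].  By Cauchy-Schwarz the total variation distance at
   [t = C n^2] is then at most [sqrt (n^2 u_t) <= (c C)^(-1/2)].
   For the Nash inequality, extend [g] to the torus, giving a removed vertex the
   value of its right neighbour: this multiplies the Dirichlet form and the
   l1-norm by at most constants, because the 8-cycle around a removed vertex is
   intact.  On the torus, comparing [h] with its translates over a box of side
   [r <= n] gives [||h||_2^2 <= r^2 E(h) + ||h||_1^2 / r^2], and for [h] of mean
   zero [||h||_2^2 <= n^2 E(h)]; it remains to choose [r]. *)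

Set Implicit Arguments.
Unset Strict Implicit.
Unset Printing Implicit Defensive.
Import Order.TTheory GRing.Theory Num.Theory.
Import numFieldNormedType.Exports.
Local Open Scope classical_set_scope.
Local Open Scope ring_scope.

(** * Shift differences on a finite abelian group *)

HB.instance Definition _ (U V : finZmodType) := GRing.Zmodule.on (U * V)%type.

Lemma sum_shift (R : nmodType) (T : finZmodType) (F : T -> R) (s : T) :
  \sum_x F (x + s) = \sum_x F x.
Proof.
rewrite [RHS](reindex (fun x => x + s)) //.
by exists (fun x => x - s) => x _; rewrite ?addrK ?subrK.
Qed.

(** This is the triangle inequality in l2 along [k] equal steps, kept in squared form to avoid
    square roots. *)
Lemma sum_sqr_shiftMn (R : realFieldType) (T : finZmodType) (h : T -> R) (s : T)
    (k : nat) :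
  \sum_x (h (x + s *+ k) - h x) ^+ 2
    <= k%:R ^+ 2 * \sum_x (h (x + s) - h x) ^+ 2.
Proof.
elim: k => [|k IH].
  rewrite mulr0n expr0n mul0r big1 // => x _.
  by rewrite addr0 subrr expr0n.
set D := \sum_x (h (x + s) - h x) ^+ 2 in IH *.
case: k => [|k] in IH *; first by rewrite mulr1n expr1n mul1r.
set a : R := k.+1%:R in IH *.
have a_gt0 : 0 < a by rewrite ltr0n.
have -> : k.+2%:R = a + 1 :> R by rewrite -natr1.
(* The weight is [a], the number of steps already made: [(1 + 1/a) a^2 + (1 + a) = (a + 1)^2]. *)
have split_sqr (p q : R) : (p + q) ^+ 2 <= (1 + a^-1) * p ^+ 2 + (1 + a) * q ^+ 2.
  rewrite -subr_ge0.
  have -> : (1 + a^-1) * p ^+ 2 + (1 + a) * q ^+ 2 - (p + q) ^+ 2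
            = a^-1 * (p - a * q) ^+ 2 by field; rewrite gt_eqF.
  by rewrite mulr_ge0 ?sqr_ge0 // invr_ge0 ltW.
apply: (@le_trans _ _ (\sum_x ((1 + a^-1) * (h (x + s *+ k.+1) - h x) ^+ 2
    + (1 + a) * (h (x + s *+ k.+1 + s) - h (x + s *+ k.+1)) ^+ 2))).
  apply: ler_sum => x _; rewrite mulrSr addrA.
  apply: le_trans (split_sqr _ _).
  by rewrite [X in _ <= X ^+ 2]addrC subrKA.
rewrite big_split -!mulr_sumr /=.
rewrite (sum_shift (fun x => (h (x + s) - h x) ^+ 2)) -/D.
have -> : (a + 1) ^+ 2 * D = (1 + a^-1) * (a ^+ 2 * D) + (1 + a) * D.
  by field; rewrite gt_eqF.
by rewrite lerD2r ler_wpM2l // addr_ge0 // invr_ge0 ltW.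
Qed.

Lemma sum_sqr_shiftD (R : realFieldType) (T : finZmodType) (h : T -> R) (p q : T) :
  \sum_x (h (x + (p + q)) - h x) ^+ 2
    <= 2 * \sum_x (h (x + p) - h x) ^+ 2 + 2 * \sum_x (h (x + q) - h x) ^+ 2.
Proof.
rewrite -(sum_shift (fun x => (h (x + q) - h x) ^+ 2) p) !mulr_sumr -big_split.
apply: ler_sum => x _ /=; rewrite addrA.
have := sqr_ge0 (h (x + p + q) - 2 * h (x + p) + h x); nra.
Qed.

(** * Dirichlet form and Poincare inequalities on the torus *)

Definition e1 (n : nat) : 'Z_n * 'Z_n := (1, 0).
Definition e2 (n : nat) : 'Z_n * 'Z_n := (0, 1).
Arguments e1 {n}.
Arguments e2 {n}.

Definition dirichlet (R : realFieldType) (n : nat) (h : 'Z_n * 'Z_n -> R) : R :=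
  \sum_(x : 'Z_n * 'Z_n) (h (x + e1) - h x) ^+ 2
    + \sum_(x : 'Z_n * 'Z_n) (h (x + e2) - h x) ^+ 2.

(** The shift [s] is [s.1] steps along [e1] followed by [s.2] steps along [e2]; the splitting costs
    2 and each run of fewer than [r] steps costs [r^2]. *)
Lemma sum_sqr_shift_box (R : realFieldType) (n r : nat) (h : 'Z_n * 'Z_n -> R)
    (s : 'Z_n * 'Z_n) :
  (s.1 < r)%N -> (s.2 < r)%N ->
  \sum_(x : 'Z_n * 'Z_n) (h (x + s) - h x) ^+ 2 <= 2 * r%:R ^+ 2 * dirichlet h.
Proof.
move=> s1r s2r.
have sE : s = e1 *+ s.1 + e2 *+ s.2.
  have pMn (p : 'Z_n * 'Z_n) k : p *+ k = (p.1 *+ k, p.2 *+ k).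
    by elim: k => [//|k IH]; rewrite !mulrS IH.
  rewrite !pMn /= !mul0rn.
  by rewrite [LHS]surjective_pairing; congr pair; rewrite /= ?addr0 ?add0r natr_Zp.
rewrite {1}sE; apply: le_trans (sum_sqr_shiftD _ _ _) _.
have step (p : 'Z_n * 'Z_n) (k : nat) : (k < r)%N ->
    \sum_(x : 'Z_n * 'Z_n) (h (x + p *+ k) - h x) ^+ 2
      <= r%:R ^+ 2 * \sum_(x : 'Z_n * 'Z_n) (h (x + p) - h x) ^+ 2.
  move=> kr; apply: le_trans (sum_sqr_shiftMn _ _ _) _.
  rewrite ler_wpM2r // -?natrX ?ler_nat ?leq_sqr 1?ltnW //.
  by apply: sumr_ge0 => x _; rewrite sqr_ge0.
by rewrite /dirichlet -mulrA mulrDr mulrDr; apply: lerD; rewrite ler_wpM2l ?step//.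
Qed.

Lemma sum_box1 (R : realFieldType) (n r : nat) : (1 < n)%N -> (r <= n)%N ->
  \sum_(s : 'Z_n * 'Z_n | (s.1 < r)%N && (s.2 < r)%N) 1 = r%:R ^+ 2 :> R.
Proof.
move=> n_gt1 rn.
have line : \sum_(i : 'Z_n | (i < r)%N) 1 = r%:R :> R.
  have rn' : (r <= (Zp_trunc n).+2)%N by rewrite Zp_cast.
  by rewrite -(big_ord_widen _ (fun=> 1) rn') sumr_const card_ord.
rewrite -(pair_big (fun i : 'Z_n => (i < r)%N) (fun i : 'Z_n => (i < r)%N)
  (fun _ _ => 1)) /=.
rewrite line (eq_bigr (fun=> r%:R * 1)); last by move=> i _; rewrite mulr1.
by rewrite -mulr_sumr line expr2.
Qed.

(* Expanding the squares in [\sum_s ||h (. + s) - h||^2], over shifts [s] in a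
   box of side [r], leaves [||h||^2] and autocorrelations of [h]. *)
Lemma box_norm_le (R : realFieldType) (n r : nat) (h : 'Z_n * 'Z_n -> R) :
  (1 < n)%N -> (r <= n)%N ->
  r%:R ^+ 2 * \sum_x h x ^+ 2 <= r%:R ^+ 2 * r%:R ^+ 2 * dirichlet h
    + \sum_x h x *
        \sum_(s : 'Z_n * 'Z_n | (s.1 < r)%N && (s.2 < r)%N) h (x + s).
Proof.
move=> n_gt1 rn; set box := fun s : 'Z_n * 'Z_n => (s.1 < r)%N && (s.2 < r)%N.
set A := \sum_x h x ^+ 2; set B := \sum_x _ * _.
have : \sum_(s | box s) \sum_(x : 'Z_n * 'Z_n) (h (x + s) - h x) ^+ 2
       <= r%:R ^+ 2 * (2 * r%:R ^+ 2 * dirichlet h).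
  rewrite -(sum_box1 R n_gt1 rn) mulr_suml; apply: ler_sum => s /andP[s1r s2r].
  by rewrite sum_box1 // mul1r sum_sqr_shift_box.
have -> : \sum_(s | box s) \sum_(x : 'Z_n * 'Z_n) (h (x + s) - h x) ^+ 2
          = 2 * (r%:R ^+ 2 * A) - 2 * B.
  have -> : B = \sum_(s | box s) \sum_x h x * h (x + s).
    by rewrite exchange_big; apply: eq_bigr => x _; rewrite mulr_sumr.
  have -> : r%:R ^+ 2 * A = \sum_(s | box s) A.
    by rewrite -(sum_box1 R n_gt1 rn) mulr_suml; apply: eq_bigr => s _; rewrite mul1r.
  rewrite -mulrBr -sumrB mulr_sumr; apply: eq_bigr => s _.
  rewrite mulrBr mulr2n mulrDl mul1r {1}/A
    -[in X in X + _](sum_shift (fun x => h x ^+ 2) s).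
  rewrite mulr_sumr -big_split -sumrB; apply: eq_bigr => x _ /=.
  by ring.
nra.
Qed.

(** The sum of [|h|] over a box based at [x] is at most the full l1-norm, so the autocorrelation
    term of [box_norm_le] is at most the square of that norm. *)
Lemma local_poincare (R : realFieldType) (n r : nat) (h : 'Z_n * 'Z_n -> R) :
  (1 < n)%N -> (r <= n)%N ->
  r%:R ^+ 2 * \sum_x h x ^+ 2 <= r%:R ^+ 2 * r%:R ^+ 2 * dirichlet h
    + (\sum_x `|h x|) ^+ 2.
Proof.
move=> n_gt1 rn; apply: le_trans (box_norm_le h n_gt1 rn) _; rewrite lerD2l.
rewrite expr2 mulr_suml; apply: ler_sum => x _.
apply: le_trans (ler_norm _) _; rewrite normrM ler_wpM2l //.
apply: le_trans (ler_norm_sum _ _ _) _.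
rewrite -(sum_shift (fun y => `|h y|) x).
rewrite [leRHS](eq_bigr (fun s => `|h (x + s)|)); last by move=> s _; rewrite addrC.
by rewrite [leLHS]big_mkcond; apply: ler_sum => s _; case: ifP.
Qed.

(** For [r = n] the box is the whole torus, and the autocorrelation term vanishes because [h] sums
    to 0. *)
Lemma poincare (R : realFieldType) (n : nat) (h : 'Z_n * 'Z_n -> R) :
  (1 < n)%N -> \sum_x h x = 0 -> \sum_x h x ^+ 2 <= n%:R ^+ 2 * dirichlet h.
Proof.
move=> n_gt1 h0; have := box_norm_le h n_gt1 (leqnn n).
rewrite [X in _ + X]big1 ?addr0; last first.
  move=> x _; rewrite (eq_bigl xpredT) => [|s]; last first.
    have ltn (i : 'Z_n) : (i < n)%N by have := ltn_ord i; rewrite {2}Zp_cast.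
    by rewrite !ltn.
  rewrite (eq_bigr (fun s => h (s + x))) => [|s _]; last by rewrite addrC.
  by rewrite sum_shift h0 mulr0.
by rewrite -mulrA ler_pM2l // exprn_gt0 // ltr0n ltnW.
Qed.

(** * Detours around removed vertices *)

Definition corners (n : nat) : seq ('Z_n * 'Z_n) := [:: 0; e1; e2; e1 + e2].

(** Two removed corners would carry different indices in [v], since [x + s] and [x + s'] differ, and
    would share a square. *)
Lemma corner_remaining (n m : nat) (v : m.-tuple (torus n)) (x s s' : 'Z_n * 'Z_n) :
  no_common_square v -> s \in corners n -> s' \in corners n -> s != s' ->
  x + s \in v -> x + s' \notin v.
Proof.
move=> sep cs cs' ss' /tnthP[a ax]; apply/negP => /tnthP[b bx].
have in_square (u : 'Z_n * 'Z_n) : u \in corners n -> x + u \in square x.1 x.2.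
  case: x {ax bx} => i j; rewrite !inE.
  by case/or4P => /eqP ->; rewrite !xpair_eqE /= ?addr0 ?add0r !eqxx ?orbT.
have [ab|ab] := eqVneq a b.
  by move: ss'; rewrite -(inj_eq (addrI x)) ax bx ab eqxx.
by apply: (sep a b x.1 x.2 ab); rewrite -ax -bx; split; apply: in_square.
Qed.

(** The value 0 at edges outside [V] lets sums range over the whole torus and be shifted. *)
Definition edge_energy (R : realFieldType) (n : nat) (V : pred ('Z_n * 'Z_n))
    (h : 'Z_n * 'Z_n -> R) (s x : 'Z_n * 'Z_n) : R :=
  if V x && V (x + s) then (h (x + s) - h x) ^+ 2 else 0.

Lemma edge_energy_ge0 (R : realFieldType) (n : nat) (V : pred ('Z_n * 'Z_n))
    (h : 'Z_n * 'Z_n -> R) (s x : 'Z_n * 'Z_n) : 0 <= edge_energy V h s x.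
Proof. by rewrite /edge_energy; case: ifP => // _; rewrite sqr_ge0. Qed.

(* An edge at a removed vertex is replaced by a detour through the at most four
   edges of [V] joining its ends along the surrounding 8-cycle. *)
Lemma dirichlet_extension_le (R : realFieldType) (n m : nat)
    (v : m.-tuple (torus n)) (h : 'Z_n * 'Z_n -> R) :
  no_common_square v -> (forall x, x \in v -> h x = h (x + e1)) ->
  dirichlet h <= 13 * (\sum_x edge_energy (fun y => y \notin v) h e1 x
                       + \sum_x edge_energy (fun y => y \notin v) h e2 x).
Proof.
move=> sep hv; set w := edge_energy _ h.
have w_ge0 s x : 0 <= w s x by exact: edge_energy_ge0.
have wE s x y : x + s = y -> x \notin v -> y \notin v -> w s x = (h y - h x) ^+ 2.
  by move=> <- xV yV; rewrite /w /edge_energy xV yV.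
have rem x s s' := @corner_remaining n m v x s s' sep.
have ne01 : (0 : 'Z_n * 'Z_n) != e1 by rewrite xpair_eqE eq_sym oner_eq0.
have ne02 : (0 : 'Z_n * 'Z_n) != e2 by rewrite xpair_eqE andbC eq_sym oner_eq0.
have ne12 : e1 != e2 :> 'Z_n * 'Z_n by rewrite xpair_eqE oner_eq0.
have ne03 : (0 : 'Z_n * 'Z_n) != e1 + e2.
  have -> : e1 + e2 = (1, 1) :> 'Z_n * 'Z_n.
    by rewrite [LHS]surjective_pairing; congr pair; rewrite /= ?addr0 ?add0r.
  by rewrite xpair_eqE eq_sym oner_eq0.
have ne13 : e1 != e1 + e2 :> 'Z_n * 'Z_n by rewrite -{1}[e1]addr0 (inj_eq (addrI _)).
have ne23 : e2 != e1 + e2 :> 'Z_n * 'Z_n by rewrite -{1}[e2]add0r (inj_eq (addIr _)).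
have c0 : 0 \in corners n by rewrite !inE eqxx.
have c1 : e1 \in corners n by rewrite !inE eqxx orbT.
have c2 : e2 \in corners n by rewrite !inE eqxx !orbT.
have c3 : e1 + e2 \in corners n by rewrite !inE eqxx !orbT.
(* Horizontal edges. If [x] is removed, the difference is 0. If [x + e1] is removed, it has the
   value of [x + e1 + e1], reached from [x] by four edges through the row above; Cauchy-Schwarz
   gives the factor 4. *)
have b1 x : (h (x + e1) - h x) ^+ 2 <= w e1 x + 4 * (w e2 (x + (e1 + e1))
    + w e1 (x + (e1 + e2)) + w e1 (x + e2) + w e2 x).
  have rhs_ge0 : 0 <= w e2 (x + (e1 + e1)) + w e1 (x + (e1 + e2)) + w e1 (x + e2)
      + w e2 x.
    by rewrite !addr_ge0.
  have [xv|xV] := boolP (x \in v).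
    by rewrite -(hv _ xv) subrr expr0n addr_ge0 // mulr_ge0.
  have [yv|yV] := boolP (x + e1 \in v); last first.
    by rewrite (wE e1 x (x + e1)) // lerDl mulr_ge0.
  have y0 : x + e1 + 0 \in v by rewrite addr0.
  have V2 := rem x e1 e2 c1 c2 ne12 yv.
  have V3 := rem x e1 _ c1 c3 ne13 yv.
  have V11 := rem (x + e1) 0 e1 c0 c1 ne01 y0.
  have V113 := rem (x + e1) 0 _ c0 c3 ne03 y0.
  rewrite (hv _ yv).
  have -> : w e2 (x + (e1 + e1)) = (h (x + e1 + (e1 + e2)) - h (x + e1 + e1)) ^+ 2.
    by rewrite [x + (e1 + e1)]addrA (wE e2 _ (x + e1 + (e1 + e2))) // -!addrA.
  have -> : w e1 (x + (e1 + e2)) = (h (x + e1 + (e1 + e2)) - h (x + (e1 + e2))) ^+ 2.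
    by rewrite (wE e1 _ (x + e1 + (e1 + e2))) // -!addrA [e2 + e1]addrC.
  have -> : w e1 (x + e2) = (h (x + (e1 + e2)) - h (x + e2)) ^+ 2.
    by rewrite (wE e1 _ (x + (e1 + e2))) // -addrA [e2 + e1]addrC.
  rewrite (wE e2 x (x + e2)) //; have := w_ge0 e1 x.
  set h0 := h x; set h1 := h (x + e2); set h2 := h (x + (e1 + e2)).
  set h3 := h (x + e1 + (e1 + e2)); set h4 := h (x + e1 + e1).
  have -> : h4 - h0 = (h4 - h3) + (h3 - h2) + (h2 - h1) + (h1 - h0) by ring.
  rewrite -[(h3 - h4) ^+ 2]sqrrN opprB.
  move: (h4 - h3) (h3 - h2) (h2 - h1) (h1 - h0) (w e1 x) => a b c d e e_ge0.
  (* The gap [4 (a^2 + b^2 + c^2 + d^2) - (a + b + c + d)^2] is the sum of these six squares. *)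
  have := sqr_ge0 (a - b); have := sqr_ge0 (a - c); have := sqr_ge0 (a - d).
  have := sqr_ge0 (b - c); have := sqr_ge0 (b - d); have := sqr_ge0 (c - d).
  by nra.
(* Vertical edges. A removed end takes the value of its right neighbour, and two edges make the
   detour: through [x + e1 + e2] if [x] is removed, through [x + e1] if [x + e2] is. *)
have b2 x : (h (x + e2) - h x) ^+ 2 <= w e2 x + 2 * (w e2 (x + e1) + w e1 (x + e2)
    + w e1 x + w e2 (x + e1)).
  have rhs_ge0 : 0 <= w e2 (x + e1) + w e1 (x + e2) + w e1 x + w e2 (x + e1).
    by rewrite !addr_ge0.
  have detour a b c : (a - c) ^+ 2 <= 2 * ((b - a) ^+ 2 + (b - c) ^+ 2) :> R.
    by have := sqr_ge0 (a - 2 * b + c); nra.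
  have [xv|xV] := boolP (x \in v).
    have x0 : x + 0 \in v by rewrite addr0.
    have V1 := rem x 0 _ c0 c1 ne01 x0.
    have V2 := rem x 0 _ c0 c2 ne02 x0.
    have V3 := rem x 0 _ c0 c3 ne03 x0.
    have -> : w e2 (x + e1) = (h (x + (e1 + e2)) - h (x + e1)) ^+ 2.
      by rewrite (wE e2 _ (x + (e1 + e2))) // addrA.
    have -> : w e1 (x + e2) = (h (x + (e1 + e2)) - h (x + e2)) ^+ 2.
      by rewrite (wE e1 _ (x + (e1 + e2))) // -addrA [e2 + e1]addrC.
    rewrite (hv _ xv).
    have := detour (h (x + e2)) (h (x + (e1 + e2))) (h (x + e1)).
    have := sqr_ge0 (h (x + (e1 + e2)) - h (x + e1)).
    by have := w_ge0 e2 x; have := w_ge0 e1 x; lra.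
  have [yv|yV] := boolP (x + e2 \in v); last first.
    by rewrite (wE e2 x (x + e2)) // lerDl mulr_ge0.
  have ne21 : e2 != e1 :> 'Z_n * 'Z_n by rewrite eq_sym.
  have V1 := rem x _ _ c2 c1 ne21 yv.
  have V3 := rem x _ _ c2 c3 ne23 yv.
  rewrite (hv _ yv) -addrA [e2 + e1]addrC.
  have -> : w e2 (x + e1) = (h (x + (e1 + e2)) - h (x + e1)) ^+ 2.
    by rewrite (wE e2 _ (x + (e1 + e2))) // addrA.
  rewrite (wE e1 x (x + e1)) //.
  have := detour (h (x + (e1 + e2))) (h (x + e1)) (h x).
  have := w_ge0 e2 x; have := w_ge0 e1 (x + e2).
  rewrite -[(h (x + e1) - h (x + (e1 + e2))) ^+ 2]sqrrN opprB.
  have := sqr_ge0 (h (x + (e1 + e2)) - h (x + e1)).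
  by lra.
(* Up to shifts, [e1]-edges are used 9 times in [b1] and 4 in [b2], [e2]-edges 8 and 5 times: 13 in
   each direction. *)
have -> : 13 * (\sum_x w e1 x + \sum_x w e2 x)
    = (\sum_x w e1 x
       + 4 * (\sum_x w e2 x + \sum_x w e1 x + \sum_x w e1 x + \sum_x w e2 x))
    + (\sum_x w e2 x
       + 2 * (\sum_x w e2 x + \sum_x w e1 x + \sum_x w e1 x + \sum_x w e2 x)).
  by ring.
apply: lerD.
  apply: le_trans (ler_sum _ (fun x _ => b1 x)) _.
  by rewrite big_split -mulr_sumr !big_split /= !sum_shift.
apply: le_trans (ler_sum _ (fun x _ => b2 x)) _.
by rewrite big_split -mulr_sumr !big_split /= !sum_shift.
Qed.

(** * The one-step operator and its loss of l2-norm *)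

Definition markov_op (R : pzSemiRingType) (T : finType) (Q : T -> T -> R) (f : T -> R)
    (x : T) : R := \sum_y Q x y * f y.

Lemma MH_sym (R : realType) (n m : nat) (v : m.-tuple (torus n)) (x y : remaining v) :
  MH R x y = MH R y x.
Proof. by rewrite /MH eq_sym torus_adjC; case: eqP => [->|]. Qed.

(** This makes the holding probability [1 - degree x / 8] at least one half. *)
Lemma degree_le4 (n m : nat) (v : m.-tuple (torus n)) (x : remaining v) :
  (degree x <= 4)%N.
Proof.
rewrite /degree cardE -(size_map val).
pose i := (val x).1; pose j := (val x).2.
apply: (@leq_trans (size [:: (i + 1, j); (i - 1, j); (i, j + 1); (i, j - 1)])) => //.
apply: uniq_leq_size; first by rewrite map_inj_uniq ?enum_uniq //; exact: val_inj.
move=> _ /mapP[y + ->]; rewrite mem_enum inE /torus_adj !inE -/i -/j.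
case: (val y) => k l /=.
case/or4P => /eqP e; try by rewrite e eqxx ?orbT.
- have -> : i = k + 1 := congr1 fst e; have -> : j = l := congr1 snd e.
  by rewrite addrK eqxx !orbT.
- have -> : i = k := congr1 fst e; have -> : j = l + 1 := congr1 snd e.
  by rewrite addrK eqxx !orbT.
Qed.

Lemma markov_op_MH (R : realType) (n m : nat) (v : m.-tuple (torus n))
    (f : remaining v -> R) (x : remaining v) :
  markov_op (@MH R n m v) f x
    = (1 - (degree x)%:R / 8) * f x + \sum_(y | torus_adj (val x) (val y)) f y / 8.
Proof.
rewrite /markov_op (bigD1 x) //= {1}/MH eqxx; congr (_ + _).
rewrite [RHS](bigID (fun y => y == x)) /= [X in _ = X + _]big1 ?add0r; last first.
  by move=> y /andP[+ /eqP yx]; rewrite yx torus_adj_irrefl.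
rewrite [RHS]big_mkcondl; apply: eq_bigr => y yx.
rewrite /MH eq_sym (negPf yx); case: ifP => _; last by rewrite mul0r.
by rewrite mulrC div1r.
Qed.

(** The sum is over ordered pairs, so each edge of [V] appears twice. *)
Definition walk_energy (R : realFieldType) (n m : nat) (v : m.-tuple (torus n))
    (g : remaining v -> R) : R :=
  \sum_x \sum_(y | torus_adj (val x) (val y)) (g y - g x) ^+ 2.

(* The left side is the sum over [x] of the variance of [g] under [Q x]; the
   holding probability is at least the total probability of moving, so every
   edge can be paired with an equal amount of mass staying at [x]. *)
Lemma walk_energy_le (R : realType) (n m : nat) (v : m.-tuple (torus n))
    (g : remaining v -> R) :
  walk_energy g / 16 <= \sum_x g x ^+ 2 - \sum_x markov_op (@MH R n m v) g x ^+ 2.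
Proof.
(* By symmetry the columns of the kernel also sum to 1, so averaging preserves total sums. *)
have -> : \sum_x g x ^+ 2 = \sum_x markov_op (@MH R n m v) (fun y => g y ^+ 2) x.
  rewrite exchange_big; apply: eq_bigr => y _ /=.
  by rewrite -mulr_suml (eq_bigr (MH R y)) ?MH_row_sum ?mul1r // => x _; exact: MH_sym.
rewrite mulr_suml -sumrB; apply: ler_sum => x _.
set a := markov_op _ g x.
have -> : markov_op (@MH R n m v) (fun y => g y ^+ 2) x - a ^+ 2
          = markov_op (@MH R n m v) (fun y => (g y - a) ^+ 2) x.
  have expand b : markov_op (@MH R n m v) (fun y => (g y - b) ^+ 2) x
      = markov_op (@MH R n m v) (fun y => g y ^+ 2) x
        - 2 * b * markov_op (@MH R n m v) g x + b ^+ 2 * \sum_y MH R x y.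
    rewrite /markov_op !mulr_sumr -sumrB -big_split; apply: eq_bigr => y _ /=.
    by ring.
  by rewrite expand MH_row_sum -/a; ring.
rewrite markov_op_MH.
apply: (@le_trans _ _ ((degree x)%:R / 8 * (g x - a) ^+ 2
    + \sum_(y | torus_adj (val x) (val y)) (g y - a) ^+ 2 / 8)); last first.
  rewrite lerD2r ler_wpM2r ?sqr_ge0 //.
  have : (degree x)%:R <= 4 :> R by rewrite ler_nat degree_le4.
  by lra.
have -> : (degree x)%:R / 8 * (g x - a) ^+ 2
    = \sum_(y : remaining v | torus_adj (val x) (val y)) (g x - a) ^+ 2 / 8.
  by rewrite sumr_const -[RHS]mulr_natl mulrA mulrAC.
rewrite -big_split mulr_suml; apply: ler_sum => y _ /=.
(* With [p = g x - a] and [q = g y - a], [p^2 + q^2 - (p - q)^2 / 2 = (p + q)^2 / 2]; together with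
   the factor 1/8 this gives 1/16. *)
by have := sqr_ge0 (g x + g y - 2 * a); nra.
Qed.

(** * Extension to the torus, the Nash inequality and the decay it implies *)

Lemma sum_remaining (R : nmodType) (n m : nat) (v : m.-tuple (torus n))
    (F : torus n -> R) :
  \sum_(y : remaining v) F (val y) = \sum_(x | x \notin v) F x.
Proof. by rewrite (big_sub (fun x => x \notin v)). Qed.

(** The default 0 is reached only if [x] and its right neighbour are both removed, which separation
    excludes. *)
Definition extend (R : realFieldType) (n m : nat) (v : m.-tuple (torus n))
    (g : remaining v -> R) (x : 'Z_n * 'Z_n) : R :=
  oapp g (oapp g 0 (insub (x + e1))) (insub x).

Lemma extend_val (R : realFieldType) (n m : nat) (v : m.-tuple (torus n))
    (g : remaining v -> R) (y : remaining v) : extend g (val y) = g y.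
Proof. by rewrite /extend valK. Qed.

Lemma extend_removed (R : realFieldType) (n m : nat) (v : m.-tuple (torus n))
    (g : remaining v -> R) (x : 'Z_n * 'Z_n) :
  no_common_square v -> x \in v -> x + e1 \notin v /\ extend g x = extend g (x + e1).
Proof.
move=> sep xv.
have yV : x + e1 \notin v.
  have ne01 : (0 : 'Z_n * 'Z_n) != e1 by rewrite xpair_eqE eq_sym oner_eq0.
  by apply: (corner_remaining sep _ _ ne01); rewrite ?addr0 // !inE eqxx ?orbT.
split=> //; rewrite /extend [insub x]insubN ?xv //=.
by case: insubP => [|/negP].
Qed.

(** The removed vertices copy values of [g] from distinct right neighbours, so they add at most one
    more l1-norm of [g]. *)
Lemma extend_norm1_le (R : realFieldType) (n m : nat) (v : m.-tuple (torus n))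
    (g : remaining v -> R) :
  no_common_square v -> \sum_x `|extend g x| <= 2 * \sum_y `|g y|.
Proof.
move=> sep; rewrite (bigID (fun x => x \in v)) /=.
have -> : \sum_y `|g y| = \sum_(x | x \notin v) `|extend g x|.
  by rewrite -sum_remaining; apply: eq_bigr => y _; rewrite extend_val.
rewrite mulr2n mulrDl mul1r lerD2r.
rewrite [leRHS]big_mkcond -(sum_shift _ e1) [leLHS]big_mkcond.
apply: ler_sum => x _; case: ifP => xv; last by case: ifP.
by have [-> ->] := extend_removed g sep xv.
Qed.

(** Seen from a remaining [y], the edges along [e1] and [e2] are two distinct terms of its neighbour
    sum; the other terms are nonnegative. *)
Lemma edge_energy_le (R : realFieldType) (n m : nat) (v : m.-tuple (torus n))
    (g : remaining v -> R) :
  \sum_x edge_energy (fun y => y \notin v) (extend g) e1 x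
  + \sum_x edge_energy (fun y => y \notin v) (extend g) e2 x <= walk_energy g.
Proof.
have toV s : \sum_x edge_energy (fun y => y \notin v) (extend g) s x
    = \sum_(y : remaining v) edge_energy (fun y => y \notin v) (extend g) s (val y).
  rewrite sum_remaining [RHS]big_mkcond; apply: eq_bigr => x _.
  by rewrite /edge_energy; case: (x \notin v).
rewrite !toV -big_split; apply: ler_sum => y _ /=.
pose F z := if torus_adj (val y) z then (extend g z - g y) ^+ 2 else 0.
have F_ge0 z : 0 <= F z by rewrite /F; case: ifP => // _; rewrite sqr_ge0.
pose G z := if z \notin v then F z else 0.
have G_ge0 z : 0 <= G z by rewrite /G; case: ifP.
have -> : \sum_(z | torus_adj (val y) (val z)) (g z - g y) ^+ 2 = \sum_z G z.
  rewrite /G -big_mkcond -(sum_remaining v F) big_mkcond; apply: eq_bigr => z _.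
  by rewrite /F extend_val.
have GE s : s = e1 \/ s = e2 ->
    edge_energy (fun y => y \notin v) (extend g) s (val y) = G (val y + s).
  move=> s12; rewrite /edge_energy (valP y) extend_val /G /F.
  suff -> : torus_adj (val y) (val y + s) by [].
  case: (val y) => i j; rewrite /torus_adj.
  by case: s12 => ->; rewrite !xpair_eqE /= !addr0 !eqxx ?orbT.
rewrite !GE; [|by right|by left].
rewrite (bigD1 (val y + e1)) //= (bigD1 (val y + e2)) /=; last first.
  by rewrite (inj_eq (addrI _)) xpair_eqE eq_sym oner_eq0.
by rewrite addrA lerDl sumr_ge0.
Qed.

(* Use the least [r] with [r^2 u >= 32], which has [r^2 u <= 128]; if [r > n],
   the Poincare inequality takes over. *)
Lemma nash_of_scales (R : archiRealFieldType) (n : nat) (u E : R) :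
  (0 < n)%N -> 0 <= u -> u <= 4 -> 0 <= E -> u <= n%:R ^+ 2 * E ->
  (forall r, (r <= n)%N -> r%:R ^+ 2 * u <= r%:R ^+ 2 * r%:R ^+ 2 * E + 16) ->
  u ^+ 2 <= 256 * E.
Proof.
move=> n_gt0 u_ge0 u_le4 E_ge0 poinc scales.
have [->|u_neq0] := eqVneq u 0; first by rewrite expr0n mulr_ge0.
have u_gt0 : 0 < u by rewrite lt_def u_neq0.
have ex : exists r : nat, 32 <= r%:R ^+ 2 * u.
  have [k] : exists k : nat, 32 / u < k%:R.
    exists (Num.bound (32 / u)); apply: le_lt_trans (archi_boundP _) => //.
    by rewrite divr_ge0.
  rewrite ltr_pdivrMr // => ku; exists k.+1.
  apply: le_trans (ltW ku) _; rewrite ler_wpM2r // -natrX ler_nat.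
  by rewrite (leq_trans (leqnSn k)) // -{1}[k.+1]expn1 leq_pexp2l.
case: (ex_minnP ex) => r r32 r_min.
(* Since [u <= 4], [r] is at least 2, hence [r <= 2 (r - 1)]; minimality gives
   [(r - 1)^2 u < 32]. *)
have r_le : r%:R ^+ 2 * u <= 128.
  have r_ge2 : (2 <= r)%N.
    rewrite ltnNge; apply/negP => r1.
    have : r%:R ^+ 2 <= 1 :> R by rewrite exprn_ile1 // (ler_nat _ r 1).
    by move: (r%:R ^+ 2) r32 => q *; nra.
  have : r.-1%:R ^+ 2 * u < 32.
    rewrite ltNge; apply/negP => /r_min; rewrite leqNgt; apply/negP/negPn.
    by rewrite prednK // ltnW.
  case: r r_ge2 {r32 r_min} => [|[|r]] // _.
  have : r.+2%:R <= 2 * r.+1%:R :> R.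
    by rewrite -natrM ler_nat mul2n -addnn addSn ltnS leq_addl.
  have : 0 <= r.+2%:R :> R by [].
  rewrite /=; move: (r.+2%:R) (r.+1%:R) => a b a_ge0 ab.
  have : a ^+ 2 <= 4 * b ^+ 2 by nra.
  by move: (a ^+ 2) (b ^+ 2) => *; nra.
have [rn|nr] := leqP r n.
  have := scales r rn; move: (r%:R ^+ 2) r32 r_le => q *.
  (* As [q u >= 32], the term 16 is at most [q u / 2]. Then [u <= 2 q E], and multiplying by [u]
     with [q u <= 128] gives 256. *)
  have : q * u <= 2 * (q * q * E) by lra.
  have q_gt0 : 0 < q by nra.
  rewrite -!mulrA mulrCA ler_pM2l // => uE.
  by nra.
have : n%:R ^+ 2 * u <= 128.
  by apply: le_trans r_le; rewrite ler_wpM2r // -!natrX ler_nat leq_sqr ltnW.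
by move: (n%:R ^+ 2) poinc => q *; nra.
Qed.

Lemma dirichlet_ge0 (R : realFieldType) (n : nat) (h : 'Z_n * 'Z_n -> R) :
  0 <= dirichlet h.
Proof. by rewrite addr_ge0 // sumr_ge0 // => x _; rewrite sqr_ge0. Qed.

Lemma nash (R : realType) (n m : nat) (v : m.-tuple (torus n)) (g : remaining v -> R) :
  (1 < n)%N -> no_common_square v -> \sum_x g x = 0 -> \sum_x `|g x| <= 2 ->
  (\sum_x g x ^+ 2) ^+ 2 <= 13 * 256 * walk_energy g.
Proof.
move=> n_gt1 sep g0 g1; set u := \sum_x g x ^+ 2; set h := extend g.
have EW : dirichlet h <= 13 * walk_energy g.
  apply: le_trans (dirichlet_extension_le sep _) _.
    by move=> x xv; case: (extend_removed g sep xv).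
  by rewrite ler_wpM2l // edge_energy_le.
suff : u ^+ 2 <= 256 * dirichlet h by lra.
have u_ge0 : 0 <= u by apply: sumr_ge0 => x _; rewrite sqr_ge0.
(* The constant [b] is kept free because the extension of a mean-zero [g] need not have mean
   zero. *)
have restrict (b : R) : \sum_x (g x - b) ^+ 2 <= \sum_x (h x - b) ^+ 2.
  rewrite (eq_bigr (fun x => (h (val x) - b) ^+ 2)); last first.
    by move=> x _; rewrite /h extend_val.
  rewrite (sum_remaining v (fun x => (h x - b) ^+ 2)) big_mkcond.
  by apply: ler_sum => x _; case: ifP => // _; rewrite sqr_ge0.
have u_le : u <= \sum_x h x ^+ 2.
  have := restrict 0; under eq_bigr do rewrite subr0.
  by under [leRHS]eq_bigr do rewrite subr0.
apply: (@nash_of_scales _ n) => //.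
- exact: ltnW.
- apply: (@le_trans _ _ ((\sum_x `|g x|) ^+ 2)).
    rewrite expr2 mulr_suml; apply: ler_sum => x _.
    rewrite -[g x ^+ 2]ger0_norm ?sqr_ge0 // expr2 normrM ler_wpM2l //.
    rewrite (bigD1 x) //= lerDl.
    by apply: sumr_ge0 => y _.
  have : 0 <= \sum_x `|g x| by apply: sumr_ge0 => x _.
  by nra.
- exact: dirichlet_ge0.
(* Centring [h] at its mean [c] leaves the Dirichlet form unchanged; on [V], subtracting [c] can
   only increase the l2-norm of [g], which sums to 0. *)
- set c := (\sum_x h x) / #|{: 'Z_n * 'Z_n}|%:R.
  have N_neq0 : #|{: 'Z_n * 'Z_n}|%:R != 0 :> R.
    by rewrite pnatr_eq0 -lt0n; apply/card_gt0P; exists 0.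
  have -> : dirichlet h = dirichlet (fun x => h x - c).
    by rewrite /dirichlet; congr (_ + _); apply: eq_bigr => x _;
      rewrite opprB addrA subrK.
  apply: le_trans (poincare n_gt1 _); last first.
    by rewrite sumrB sumr_const -mulr_natr /c divfK ?subrr.
  apply: le_trans (restrict c).
  have -> : \sum_x (g x - c) ^+ 2
      = u - 2 * c * (\sum_x g x) + \sum_(x : remaining v) c ^+ 2.
    rewrite mulr_sumr -sumrB -big_split; apply: eq_bigr => x _ /=; by ring.
  by rewrite g0 mulr0 subr0 lerDl sumr_ge0 // => x _; rewrite sqr_ge0.
(* The 16 is the square of the bound [2 * 2] on the l1-norm of [h]. *)
move=> r rn; apply: le_trans (le_trans (local_poincare h n_gt1 rn) _).
  by rewrite ler_wpM2l // sqr_ge0.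
rewrite lerD2l; have := extend_norm1_le g sep.
have : 0 <= \sum_x `|h x| by apply: sumr_ge0 => x _.
by rewrite /h; nra.
Qed.

(** This is the discrete form of [u' = - u^2 / c], whose nonnegative solutions satisfy
    [t u(t) <= c]. *)
Lemma quadratic_decay (R : realFieldType) (c : R) (u : nat -> R) (t : nat) :
  0 < c -> (forall k, 0 <= u k) -> (forall k, u k ^+ 2 <= c * (u k - u k.+1)) ->
  t%:R * u t <= c.
Proof.
move=> c_gt0 u_ge0 step; elim: t => [|t IH]; first by rewrite mul0r ltW.
rewrite -natr1; have := step t; have := u_ge0 t; have := u_ge0 t.+1.
move: (u t) (u t.+1) IH => w w' tw w'_ge0 w_ge0 dw.
have : 0 <= t%:R :> R by [].
move: (t%:R) tw => s sw s_ge0.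
rewrite -(ler_pM2l c_gt0) mulrCA.
apply: (@le_trans _ _ ((s + 1) * (c * w - w ^+ 2))); first by rewrite ler_wpM2l //; lra.
have w_le : w <= c.
  have [//|cw] := leP w c; have : c * w <= w ^+ 2 by nra.
  by nra.
(* The gap is [c^2 - (s + 1) (c w - w^2) = (c - s w) (c - w) + w^2]. *)
have : 0 <= (c - s * w) * (c - w) by rewrite mulr_ge0 // subr_ge0.
by nra.
Qed.

(** * The law of the chain as an iterate of the operator *)

Lemma measure_preimage_sum d (Omega : measurableType d) (R : realType)
    (mu : {measure set Omega -> \bar R}) (T : finType) (Y : Omega -> T) (A : set Omega) :
  measurable A -> (forall z, measurable (Y @^-1` [set z])) ->
  mu A = (\sum_z mu (A `&` Y @^-1` [set z]))%E.
Proof.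
move=> mA mY; rewrite (bigfs _ _ (P := xpredT)) ?index_enum_uniq //; last first.
  by move=> z _; rewrite mem_index_enum.
rewrite -measure_fin_bigcup; last 3 first.
- exact: finite_finset.
- by move=> z z' _ _ [w [[_ <-] [_ <-]]].
- by move=> z _; exact: measurableI.
congr (mu _); apply/seteqP; split=> w; last by move=> [z _ []].
by move=> Aw; exists (Y w).
Qed.

Lemma historyS (Omega T : Type) (X : nat -> Omega -> T) (h : nat -> T) (s : nat) :
  history X h s.+1 = history X h s `&` X s.+1 @^-1` [set h s.+1].
Proof.
apply/seteqP; split=> w /=.
  by move=> hw; split=> [i si|]; apply: hw => //; exact: leq_trans si _.
move=> [hw hs] i; rewrite leq_eqVlt => /predU1P[->//|].
by rewrite ltnS; exact: hw.
Qed.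

Lemma history0 (Omega T : Type) (X : nat -> Omega -> T) (h : nat -> T) :
  history X h 0 = X 0%N @^-1` [set h 0%N].
Proof.
apply/seteqP; split=> w /= => [hw|hw i]; first exact: hw.
by rewrite leqn0 => /eqP ->.
Qed.

Lemma eq_history (Omega T : Type) (X : nat -> Omega -> T) (h h' : nat -> T) (s : nat) :
  (forall i, (i <= s)%N -> h i = h' i) -> history X h s = history X h' s.
Proof.
by move=> hh'; apply/seteqP; split=> w hw i si; rewrite hw // hh'.
Qed.

Definition indic_fun (R : pzSemiRingType) (T : eqType) (y x : T) : R := (x == y)%:R.

(** This is the Markov property over [k] steps, free of denominators. Keeping [h] and [s] general
    lets the induction on [k] lengthen the history by one step. *)
Lemma history_hit d (Omega : measurableType d) (R : realType) (P : probability Omega R)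
    (T : finType) (Q : T -> T -> R) (x0 : T) (X : nat -> Omega -> T) (y : T) :
  markov_chain P Q x0 X -> forall (k : nat) (h : nat -> T) (s : nat),
  P (history X h s `&` X (s + k)%N @^-1` [set y])
    = (P (history X h s) * (iter k (markov_op Q) (indic_fun R y) (h s))%:E)%E.
Proof.
move=> [mX _ step].
have mH h s : measurable (history X h s).
  elim: s => [|s IH]; first by rewrite history0.
  by rewrite historyS; exact: measurableI.
elim=> [|k IH] h s.
  rewrite addn0 /= /indic_fun; have [hy|hy] := eqVneq (h s) y.
    rewrite mule1; congr (P _); apply/seteqP; split=> w; first by case.
    by move=> hw; split=> //=; rewrite hw.
  rewrite mule0 -(measure0 P); congr (P _); apply/seteqP; split=> w //= [hw].
  by rewrite hw // => /eqP; rewrite (negPf hy).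
(* [ext z] prolongs the history by the value [z] at time [s + 1]; summing over [z] is total
   probability. *)
pose ext z i := if (i <= s)%N then h i else z.
have hE z : history X (ext z) s = history X h s.
  by apply: eq_history => i si; rewrite /ext si.
have extS z : ext z s.+1 = z by rewrite /ext ltnn.
have exts z : ext z s = h s by rewrite /ext leqnn.
rewrite (measure_preimage_sum P _ (mX s.+1)); last exact: measurableI.
rewrite (eq_bigr (fun z => (P (history X h s)
    * (Q (h s) z * iter k (markov_op Q) (indic_fun R y) z)%:E)%E)); last first.
  move=> z _; have := IH (ext z) s.+1.
  rewrite step hE extS exts historyS hE extS addSnnS setIAC => e.
  by apply: etrans e _; rewrite EFinM muleA.
have Pfin : P (history X h s) \is a fin_num by exact: fin_num_measure.
rewrite -(fineK Pfin); under eq_bigr do rewrite -EFinM.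
by rewrite sumEFin -EFinM -mulr_sumr.
Qed.

Lemma markov_op_iter_sym (R : comPzSemiRingType) (T : finType) (Q : T -> T -> R)
    (k : nat) (f g : T -> R) : (forall x y, Q x y = Q y x) ->
  \sum_x f x * iter k (markov_op Q) g x = \sum_x iter k (markov_op Q) f x * g x.
Proof.
move=> Qsym; elim: k f => [//|k IH] f; rewrite iterS iterSr -IH.
have -> : \sum_x f x * markov_op Q (iter k (markov_op Q) g) x
    = \sum_x \sum_y f x * (Q x y * iter k (markov_op Q) g y).
  by apply: eq_bigr => x _; rewrite mulr_sumr.
rewrite exchange_big; apply: eq_bigr => y _ /=.
rewrite mulr_suml; apply: eq_bigr => x _.
by rewrite mulrCA mulrA [Q x y]Qsym.
Qed.

(** The Markov property gives the iterate of the indicator of [y] evaluated at [x0];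
    self-adjointness exchanges [x0] and [y], so that the law itself evolves by the operator. *)
Lemma law_markov_chain d (Omega : measurableType d) (R : realType)
    (P : probability Omega R) (T : finType) (Q : T -> T -> R) (x0 : T)
    (X : nat -> Omega -> T) (t : nat) (y : T) :
  (forall x y, Q x y = Q y x) -> markov_chain P Q x0 X ->
  law P (X t) y = iter t (markov_op Q) (indic_fun R x0) y.
Proof.
move=> Qsym chainX; have [mX start _] := chainX.
have null z : z != x0 -> P (X 0%N @^-1` [set z]) = 0%E.
  move=> zx0; apply/eqP; rewrite -measure_le0.
  have -> : (0 = P (~` (X 0%N @^-1` [set x0])))%E.
    by rewrite probability_setC // start subee.
  apply: le_measure; rewrite ?inE //; first exact: measurableC.
  by move=> w /= -> /eqP; rewrite (negPf zx0).
have Pt : P (X t @^-1` [set y]) = (iter t (markov_op Q) (indic_fun R y) x0)%:E.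
  rewrite (measure_preimage_sum P (mX t y) (mX 0%N)).
  rewrite (eq_bigr (fun z => (P (X 0%N @^-1` [set z])
      * (iter t (markov_op Q) (indic_fun R y) z)%:E)%E)); last first.
    by move=> z _; rewrite setIC -(history0 _ (fun=> z)) -(history_hit y chainX).
  rewrite (bigD1 x0) //= start mul1e big1 ?adde0 // => z zx0.
  by rewrite null // mul0e.
rewrite /law Pt /=.
have pick (f : T -> R) (a : T) : \sum_x indic_fun R a x * f x = f a.
  rewrite (bigD1 a) //= /indic_fun eqxx mul1r big1 ?addr0 // => x /negPf ->.
  by rewrite mul0r.
rewrite -(pick (iter t _ _) x0) (markov_op_iter_sym t _ _ Qsym) -[RHS]pick.
by apply: eq_bigr => x _; rewrite mulrC.
Qed.

(** * From l2 decay to total variation *)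

(** Cauchy-Schwarz: with [N = #|T|] and [S] the l1-norm, [N] times the gap is the sum of
    [(N |g x| - S)^2]. *)
Lemma sqr_norm1_le (R : realFieldType) (T : finType) (g : T -> R) :
  (\sum_x `|g x|) ^+ 2 <= #|T|%:R * \sum_x g x ^+ 2.
Proof.
have [T0|T_gt0] := posnP #|T|.
  by rewrite T0 mul0r big1 ?expr0n // => x; case: (fintype0 x T0).
set S := \sum_x `|g x|; have N_gt0 : 0 < #|T|%:R :> R by rewrite ltr0n.
rewrite -subr_ge0 -(pmulr_rge0 _ N_gt0).
have -> : #|T|%:R * (#|T|%:R * \sum_x g x ^+ 2 - S ^+ 2)
          = \sum_x (#|T|%:R * `|g x| - S) ^+ 2.
  have expand (a b : R) : \sum_x (a * `|g x| - b) ^+ 2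
      = a ^+ 2 * \sum_x g x ^+ 2 - 2 * a * b * \sum_x `|g x| + \sum_(x : T) b ^+ 2.
    rewrite !mulr_sumr -sumrB -big_split; apply: eq_bigr => x _ /=.
    by rewrite -[g x ^+ 2]ger0_norm ?sqr_ge0 // normrX; ring.
  by rewrite expand -/S sumr_const -mulr_natl; ring.
by apply: sumr_ge0 => x _; rewrite sqr_ge0.
Qed.

Lemma tv_dist_le (R : realType) (T : finType) (mu nu : T -> R) :
  tv_dist mu nu <= \sum_x `|mu x - nu x|.
Proof.
apply: bigmax_le => [|A _]; first by apply: sumr_ge0 => x _.
rewrite -sumrB; apply: le_trans (ler_norm_sum _ _ _) _.
by rewrite big_mkcond; apply: ler_sum => x _; case: ifP.
Qed.

(** In the constant, 16 comes from the one-step energy loss and [13 * 256] from [nash]. *)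
Lemma walk_l2_decay (R : realType) (n m : nat) (v : m.-tuple (torus n))
    (x0 : remaining v) (t : nat) :
  (1 < n)%N -> no_common_square v ->
  t%:R * \sum_x (iter t (markov_op (@MH R n m v)) (indic_fun R x0) x
                 - uniform_dist R x) ^+ 2 <= 16 * (13 * 256).
Proof.
move=> n_gt1 sep; set p := fun k => iter k (markov_op (@MH R n m v)) (indic_fun R x0).
have N_gt0 : 0 < #|remaining v|%:R :> R by rewrite ltr0n; apply/card_gt0P; exists x0.
have sum_unif : \sum_(x : remaining v) uniform_dist R x = 1.
  by rewrite sumr_const /uniform_dist -[LHS]mulr_natr mulVf // gt_eqF.
have MH_ge0 x y : 0 <= MH R x y :> R.
  rewrite /MH; case: eqP => _; last by case: ifP.
  by have : (degree x)%:R <= 4 :> R; [rewrite ler_nat degree_le4|lra].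
have p_ge0 k x : 0 <= p k x.
  elim: k x => [|k IH] x; first by rewrite /p /indic_fun /=.
  by rewrite /p iterS; apply: sumr_ge0 => y _; rewrite mulr_ge0 // IH.
have sum_p k : \sum_x p k x = 1.
  elim: k => [|k <-].
    rewrite (bigD1 x0) //= /p /= /indic_fun eqxx big1 ?addr0 // => x /negPf.
    by move=> ->.
  rewrite {1}/p iterS exchange_big; apply: eq_bigr => y _ /=.
  rewrite -mulr_suml (eq_bigr (MH R y)) ?MH_row_sum ?mul1r // => x _.
  exact: MH_sym.
apply: (@quadratic_decay R _ (fun k => \sum_x (p k x - uniform_dist R x) ^+ 2)) => // k.
  by apply: sumr_ge0 => x _; rewrite sqr_ge0.
pose g x := p k x - uniform_dist R x.
(* The uniform distribution is fixed by the operator, so the deviation [g] evolves by the operator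
   too. *)
have gS x : p k.+1 x - uniform_dist R x = markov_op (@MH R n m v) g x.
  rewrite /p iterS /markov_op /g -[uniform_dist R x]mulr1 -(MH_row_sum R x).
  rewrite mulr_sumr -sumrB.
  by apply: eq_bigr => y _; rewrite mulrBr [uniform_dist R y * _]mulrC.
have sum_g : \sum_x g x = 0 by rewrite sumrB sum_p sum_unif subrr.
have norm_g : \sum_x `|g x| <= 2.
  apply: (@le_trans _ _ (\sum_x (p k x + uniform_dist R x))).
    apply: ler_sum => x _; apply: le_trans (ler_normB _ _) _.
    by rewrite !ger0_norm // /uniform_dist invr_ge0 ler0n.
  by rewrite big_split /= sum_p sum_unif.
rewrite [X in _ - X](eq_bigr (fun x => markov_op (@MH R n m v) g x ^+ 2)); last first.
  by move=> x _; rewrite gS.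
by have := nash n_gt1 sep sum_g norm_g; have := walk_energy_le g; rewrite /g; lra.
Qed.

Lemma cvg_sqrt_div_pinfty (R : realType) (a : R) :
  Num.sqrt (a / C) @[C --> +oo] --> (0 : R).
Proof.
have cv0 : (a / C) @[C --> +oo] --> (0 : R).
  rewrite -(mulr0 a); apply: cvgMl_tmp.
  by apply/gtr0_cvgV0; [exact: nbhs_pinfty_gt|exact: cvg_id].
rewrite -(sqrtr0 R).
exact: cvg_comp cv0 (@sqrt_continuous R 0).
Qed.

Theorem theorem9 (R : realType) :
  exists f : R -> R,
    (forall C : R, 0 < C -> 0 <= f C) /\
    (f C @[C --> +oo] --> (0 : R)) /\
    (forall (n m : nat) (v : m.-tuple (torus n)),
      (3 <= n)%N -> uniq v -> no_common_square v ->
      forall (d : measure_display) (Omega : measurableType d)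
        (P : probability Omega R) (x0 : remaining v)
        (X : nat -> Omega -> remaining v),
      markov_chain P (@MH R n m v) x0 X ->
      forall (C : R) (t : nat), 0 < C -> t%:R = C * n%:R ^+ 2 ->
      tv_dist (law P (X t)) (@uniform_dist R (remaining v)) <= f C).
Proof.
(* The numerator is the constant of [walk_l2_decay]: the squared l1-distance is at most [n^2 u],
   while [C n^2 u = t u] is at most that constant. *)
exists (fun C => Num.sqrt (16 * (13 * 256) / C)); split.
  by move=> C _; exact: sqrtr_ge0.
split.
  exact: cvg_sqrt_div_pinfty.
move=> n m v n_ge3 _ sep d Omega P x0 X chainX C t C_gt0 tE.
have n_gt1 : (1 < n)%N by exact: leq_trans n_ge3.
apply: le_trans (tv_dist_le _ _) _.
rewrite -[leLHS]ger0_norm ?sumr_ge0 // -sqrtr_sqr ler_wsqrtr //.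
apply: le_trans (sqr_norm1_le _) _.
have := walk_l2_decay R x0 t n_gt1 sep.
under eq_bigr do rewrite -(law_markov_chain t _ (@MH_sym R n m v) chainX).
set u := \sum_x _ => tu.
have u_ge0 : 0 <= u by apply: sumr_ge0 => x _; rewrite sqr_ge0.
have N_le : #|remaining v|%:R <= n%:R ^+ 2 :> R.
  rewrite -natrX ler_nat card_sig (leq_trans (max_card _)) //.
  by rewrite card_prod card_ord Zp_cast.
rewrite ler_pdivlMr //; apply: le_trans tu; rewrite tE mulrC mulrA.
by rewrite ler_wpM2r // ler_pM2l.
Qed.
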